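(* Let $R$ be a commutative artin ring, $\mathcal{C}$ a dualizing $R$-variety and $\mathcal{I}$ an ideal of $\mathcal{C}$ which satisfies property (A). Then $\mathcal{C}/\mathcal{I}$ is a dualizing $R$-variety and the diagram $$\begin{array}{ccc}\mathrm{mod}(\mathcal{C}/\mathcal{I})&\xrightarrow{(\pi_{1})_{\ast}}&\mathrm{mod}(\mathcal{C})\\ {\scriptstyle\mathbb{D}_{\mathcal{C}/\mathcal{I}}}\downarrow&&\downarrow{\scriptstyle\mathbb{D}_{\mathcal{C}}}\\ \mathrm{mod}((\mathcal{C}/\mathcal{I})^{op})&\xrightarrow{(\pi_{2})_{\ast}}&\mathrm{mod}(\mathcal{C}^{op})\end{array}$$ is commutative.
   Context: A Hom-finite $R$-variety is a small additive category in which idempotents split, whose Hom-sets are finitely generated $R$-modules with $R$-bilinear composition. For such $\mathcal{C}$, $\mathrm{Mod}(\mathcal{C})$ is the category of additive functors $\mathcal{C}\to\mathbf{Ab}$ (equivalently to $\mathrm{Mod}(R)$), $\mathrm{mod}(\mathcal{C})$ is the full subcategory of finitely presented functors (those $M$ with an exact sequence $\mathrm{Hom}_{\mathcal{C}}(C_0,-)\to\mathrm{Hom}_{\mathcal{C}}(C_1,-)\to M\to0$), and $(\mathcal{C},\mathrm{mod}(R))$ is the full subcategory of functors with finitely generated values. Let $E$ be the injective envelope of $R/\mathrm{rad}(R)$. The duality $\mathbb{D}_{\mathcal{C}}:(\mathcal{C},\mathrm{mod}(R))\to(\mathcal{C}^{op},\mathrm{mod}(R))$ is $\mathbb{D}_{\mathcal{C}}(M)(C)=\mathrm{Hom}_R(M(C),E)$.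 $\mathcal{C}$ is dualizing if $\mathbb{D}_{\mathcal{C}}$ induces a duality between $\mathrm{mod}(\mathcal{C})$ and $\mathrm{mod}(\mathcal{C}^{op})$. An ideal $\mathcal{I}$ is a family of subgroups $\mathcal{I}(A,B)\subseteq\mathrm{Hom}_{\mathcal{C}}(A,B)$ closed under composition on either side with arbitrary morphisms; $\mathcal{C}/\mathcal{I}$ has the same objects and Hom-sets $\mathrm{Hom}_{\mathcal{C}}(A,B)/\mathcal{I}(A,B)$. $\mathcal{I}$ satisfies property (A) if for every $C\in\mathcal{C}$ there exist $X,Y\in\mathcal{C}$ and epimorphisms $\mathrm{Hom}_{\mathcal{C}}(X,-)\to\mathcal{I}(C,-)\to0$ and $\mathrm{Hom}_{\mathcal{C}}(-,Y)\to\mathcal{I}(-,C)\to0$. $\pi_1:\mathcal{C}\to\mathcal{C}/\mathcal{I}$ and $\pi_2:\mathcal{C}^{op}\to(\mathcal{C}/\mathcal{I})^{op}$ are the canonical functors, and $(\pi_j)_{\ast}(F)=F\circ\pi_j$. *)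

(* Defs.v *)
From HB Require Import structures.
From mathcomp Require Import all_boot all_algebra.
From mathcomp Require Import boolp.

Set Implicit Arguments.
Unset Strict Implicit.
Unset Printing Implicit Defensive.

Import GRing.Theory.
Local Open Scope ring_scope.
Local Open Scope quotient_scope.
Local Obligation Tactic := idtac.

Section Hom.
Variable R : comPzRingType.

Lemma linear_ext (U V : lmodType R) (f g : {linear U -> V}) : f =1 g -> f = g.
Proof.
case: f g => [f [[a] [s]]] [g [[b] [t]]] /= /funext fg.
by case: g / fg b t => b t; rewrite (Prop_irrelevance a b) (Prop_irrelevance s t).
Qed.

Definition homR (U V : lmodType R) : Type := {linear U -> V}.

Variables U V : lmodType R.
Implicit Types f g h : homR U V.

HB.instance Definition _ := gen_eqMixin (homR U V).
HB.instance Definition _ := gen_choiceMixin (homR U V).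

Definition homR0 : homR U V := \0 : {linear U -> V}.
Definition homR_add f g : homR U V :=
  ((f : {linear U -> V}) \+ (g : {linear U -> V})) : {linear U -> V}.
Definition homR_opp f : homR U V :=
  (\- (f : {linear U -> V})) : {linear U -> V}.
Definition homR_scale (a : R) f : homR U V :=
  (a \*: (f : {linear U -> V})) : {linear U -> V}.

Lemma homR_addA : associative homR_add.
Proof. by move=> f g h; apply: linear_ext => x /=; rewrite addrA. Qed.
Lemma homR_addC : commutative homR_add.
Proof. by move=> f g; apply: linear_ext => x /=; rewrite addrC. Qed.
Lemma homR_add0 : left_id homR0 homR_add.
Proof. by move=> f; apply: linear_ext => x /=; rewrite add0r. Qed.
Lemma homR_addN : left_inverse homR0 homR_opp homR_add.
Proof. by move=> f; apply: linear_ext => x /=; rewrite addNr. Qed.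

HB.instance Definition _ := GRing.isZmodule.Build (homR U V)
  homR_addA homR_addC homR_add0 homR_addN.

Lemma homR_scaleA a b f :
  homR_scale a (homR_scale b f) = homR_scale (a * b) f.
Proof. by apply: linear_ext => x /=; rewrite scalerA. Qed.
Lemma homR_scale1 : left_id 1 homR_scale.
Proof. by move=> f; apply: linear_ext => x /=; rewrite scale1r. Qed.
Lemma homR_scaleDr : right_distributive homR_scale +%R.
Proof. by move=> a f g; apply: linear_ext => x /=; rewrite scalerDr. Qed.
Lemma homR_scaleDl f : {morph homR_scale^~ f : a b / a + b}.
Proof. by move=> a b; apply: linear_ext => x /=; rewrite scalerDl. Qed.

HB.instance Definition _ := GRing.Zmodule_isLmodule.Build R (homR U V)
  homR_scaleA homR_scale1 homR_scaleDr homR_scaleDl.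

End Hom.

Section Precomposition.
Variables (R : comPzRingType) (U V W : lmodType R) (f : {linear U -> V}).

Definition precomp (g : homR V W) : homR U W :=
  ((g : {linear V -> W}) \o f) : {linear U -> W}.

Lemma precomp_linear : linear precomp.
Proof. by move=> a g h; apply: linear_ext. Qed.

HB.instance Definition _ :=
  GRing.isLinear.Build R (homR V W) (homR U W) *:%R precomp precomp_linear.

End Precomposition.

Section SubQuotient.
Variables (R : comPzRingType) (V : lmodType R) (S : submodClosed V).

Definition sublmod : Type := {x : V | x \in S}.
HB.instance Definition _ := SubChoice.on sublmod.
HB.instance Definition _ := [SubChoice_isSubLmodule of sublmod by <:].

(* A [submodClosed] predicate on a module over a ring is closed under opposite. *)
Definition smem : {pred V} := fun x => x \in S.

Lemma smem_closed : subsemimod_closed smem.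
Proof. exact: GRing.subsemimodClosedP. Qed.
HB.instance Definition _ := GRing.isSubmodClosed.Build R V smem smem_closed.

Definition quolmod : Type := Quotient.quot smem.
HB.instance Definition _ := GRing.Zmodule.on quolmod.

Definition quo_pi (x : V) : quolmod := \pi_(Quotient.quot smem) x.
Definition quo_repr (x : quolmod) : V := repr (x : Quotient.quot smem).

Lemma quo_reprK x : quo_pi (quo_repr x) = x.
Proof. exact: reprK. Qed.

Lemma quo_piE x y : (quo_pi x = quo_pi y) <-> (x - y \in S).
Proof.
have -> : (x - y \in S) = (x - y \in smem) by [].
rewrite Quotient.idealrBE; split=> [xy|/eqP //].
by apply/eqP; exact: xy.
Qed.

Lemma quo_piD x y : quo_pi (x + y) = quo_pi x + quo_pi y.
Proof. exact: (raddfD (\pi_(Quotient.quot smem))). Qed.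

Definition quo_scale (a : R) (x : quolmod) : quolmod := quo_pi (a *: quo_repr x).

Lemma quo_scale_pi a x : quo_scale a (quo_pi x) = quo_pi (a *: x).
Proof.
apply/quo_piE; rewrite -scalerBr; apply: rpredZ; apply/quo_piE.
exact: quo_reprK.
Qed.

Lemma quo_scaleA a b x : quo_scale a (quo_scale b x) = quo_scale (a * b) x.
Proof. by rewrite -(quo_reprK x) !quo_scale_pi scalerA. Qed.
Lemma quo_scale1 : left_id 1 quo_scale.
Proof. by move=> x; rewrite -(quo_reprK x) quo_scale_pi scale1r. Qed.
Lemma quo_scaleDr : right_distributive quo_scale +%R.
Proof.
move=> a x y; rewrite -(quo_reprK x) -(quo_reprK y) -quo_piD !quo_scale_pi.
by rewrite scalerDr quo_piD.
Qed.
Lemma quo_scaleDl x : {morph quo_scale^~ x : a b / a + b}.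
Proof.
by move=> a b; rewrite -(quo_reprK x) !quo_scale_pi scalerDl quo_piD.
Qed.

HB.instance Definition _ := GRing.Zmodule_isLmodule.Build R quolmod
  quo_scaleA quo_scale1 quo_scaleDr quo_scaleDl.

Lemma quo_pi_linear : linear quo_pi.
Proof. by move=> a x y; rewrite quo_piD -quo_scale_pi. Qed.
HB.instance Definition _ :=
  GRing.isLinear.Build R V quolmod *:%R quo_pi quo_pi_linear.

End SubQuotient.

Definition fin_gen (R : comPzRingType) (V : lmodType R) : Prop :=
  exists (n : nat) (v : 'I_n -> V),
    forall x : V, exists c : 'I_n -> R, x = \sum_(i < n) c i *: v i.

Definition is_injective (R : comPzRingType) (E : lmodType R) : Prop :=
  forall (A B : lmodType R) (i : {linear A -> B}) (f : {linear A -> E}),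
    injective i -> exists g : {linear B -> E}, forall x, g (i x) = f x.

Definition is_essential (R : comPzRingType) (V E : lmodType R)
    (i : {linear V -> E}) : Prop :=
  forall S : submodClosed E,
    (forall v : V, i v \in S -> i v = 0) -> forall x : E, x \in S -> x = 0.

Definition is_injective_envelope (R : comPzRingType) (V E : lmodType R) : Prop :=
  is_injective E /\
  exists i : {linear V -> E}, injective i /\ is_essential i.

(* Ideals of R are represented as submodules of the regular module [R^o]. *)

Definition artinian (R : comPzRingType) : Prop :=
  forall J : nat -> submodClosed R^o,
    (forall n, {subset J n.+1 <= J n}) ->
    exists n, forall m, (n <= m)%N -> J m =i J n.

Definition maximal_ideal (R : comPzRingType) (m : submodClosed R^o) : Prop :=
  (1 : R^o) \notin m /\
  forall J : submodClosed R^o,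
    {subset m <= J} -> (1 : R^o) \notin J -> {subset J <= m}.

Section Radical.
Variable R : comPzRingType.

Definition rad : {pred R^o} :=
  fun x => `[< forall m : submodClosed R^o, maximal_ideal m -> x \in m >].

Lemma rad_submod_closed : submod_closed rad.
Proof.
split; first by apply/asboolP => m _; rewrite rpred0.
move=> a x y /asboolP rx /asboolP ry; apply/asboolP => m mm.
by rewrite rpredD ?rpredZ ?rx ?ry.
Qed.
HB.instance Definition _ := GRing.isSubmodClosed.Build R R^o rad (GRing.submod_closed_semi rad_submod_closed).

End Radical.

Definition quo_rad (R : comPzRingType) : lmodType R :=
  quolmod (@rad R : submodClosed R^o).

Record category := Category {
  cobj :> Type;
  mor : cobj -> cobj -> Type;
  idc : forall A, mor A A;
  compc : forall A B C, mor B C -> mor A B -> mor A C;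
  idcl : forall A B (f : mor A B), compc (idc B) f = f;
  idcr : forall A B (f : mor A B), compc f (idc A) = f;
  compcA : forall A B C D (h : mor C D) (g : mor B C) (f : mor A B),
    compc h (compc g f) = compc (compc h g) f }.
Arguments idc {c} A.

Definition op_cat (K : category) : category :=
  @Category (cobj K) (fun A B => mor B A) (@idc K)
    (fun A B C g f => compc f g)
    (fun A B f => idcr f) (fun A B f => idcl f)
    (fun A B C D h g f => esym (compcA f g h)).

Definition full_subcat (K : category) (P : K -> Prop) : category :=
  @Category {A : K | P A} (fun A B => mor (sval A) (sval B))
    (fun A => idc (sval A)) (fun A B C g f => compc g f)
    (fun A B f => idcl f) (fun A B f => idcr f)
    (fun A B C D h g f => compcA h g f).

Record functor (K L : category) := Functor {
  fobj :> K -> L;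
  fmap : forall A B, mor A B -> mor (fobj A) (fobj B);
  fmap_id : forall A, fmap (idc A) = idc (fobj A);
  fmap_comp : forall A B C (g : mor B C) (f : mor A B),
    fmap (compc g f) = compc (fmap g) (fmap f) }.

Definition id_functor (K : category) : functor K K :=
  @Functor K K (fun A => A) (fun A B f => f)
    (fun A => erefl) (fun A B C g f => erefl).

Program Definition comp_functor (K L M : category)
    (G : functor L M) (F : functor K L) : functor K M :=
  @Functor K M (fun A => G (F A)) (fun A B f => fmap G (fmap F f)) _ _.
Next Obligation. by move=> K L M G F A; rewrite /= !fmap_id. Qed.
Next Obligation. by move=> K L M G F A B C g f; rewrite /= !fmap_comp. Qed.

Definition op_functor (K L : category) (F : functor K L) :
    functor (op_cat K) (op_cat L) :=
  @Functor (op_cat K) (op_cat L) (fobj F) (fun A B f => fmap F f)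
    (fmap_id F) (fun A B C g f => fmap_comp F f g).

Definition restrict_functor (K L : category) (P : K -> Prop) (Q : L -> Prop)
    (F : functor K L) (PQ : forall A, P A -> Q (F A)) :
    functor (full_subcat P) (full_subcat Q) :=
  @Functor (full_subcat P) (full_subcat Q)
    (fun A => exist _ (F (sval A)) (PQ _ (svalP A))) (fun A B f => fmap F f)
    (fun A => fmap_id F _) (fun A B C g f => fmap_comp F g f).

Definition restrict_cofunctor (K L : category) (P : K -> Prop) (Q : L -> Prop)
    (F : functor (op_cat K) L) (PQ : forall A : K, P A -> Q (F A)) :
    functor (op_cat (full_subcat P)) (full_subcat Q) :=
  @Functor (op_cat (full_subcat P)) (full_subcat Q)
    (fun A => exist _ (F (sval A)) (PQ _ (svalP A))) (fun A B f => fmap F f)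
    (fun A => fmap_id F _) (fun A B C g f => fmap_comp F g f).

Definition nat_iso (K L : category) (F G : functor K L) : Prop :=
  exists (a : forall A, mor (F A) (G A)) (b : forall A, mor (G A) (F A)),
    [/\ forall A B (f : mor A B), compc (a B) (fmap F f) = compc (fmap G f) (a A),
        forall A, compc (b A) (a A) = idc (F A)
      & forall A, compc (a A) (b A) = idc (G A)].

Definition is_equivalence (K L : category) (F : functor K L) : Prop :=
  exists G : functor L K,
    nat_iso (comp_functor G F) (id_functor K) /\
    nat_iso (comp_functor F G) (id_functor L).

Section LinearCategories.
Variable R : comPzRingType.

Record lcat := LCat {
  lobj :> Type;
  lhom : lobj -> lobj -> lmodType R;
  lid : forall A, lhom A A;
  lcomp : forall A B C, lhom B C -> lhom A B -> lhom A C;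
  lidl : forall A B (f : lhom A B), lcomp (lid B) f = f;
  lidr : forall A B (f : lhom A B), lcomp f (lid A) = f;
  lcompA : forall A B C D (h : lhom C D) (g : lhom B C) (f : lhom A B),
    lcomp h (lcomp g f) = lcomp (lcomp h g) f;
  lcomp_linearr : forall A B C (g : lhom B C), linear (@lcomp A B C g);
  lcomp_linearl : forall A B C (f : lhom A B),
    linear (fun g : lhom B C => lcomp g f) }.
Arguments lid {l} A.

Definition op_lcat (C : lcat) : lcat :=
  @LCat (lobj C) (fun A B => lhom B A) (@lid C) (fun A B D g f => lcomp f g)
    (fun A B f => lidr f) (fun A B f => lidl f)
    (fun A B D D' h g f => esym (lcompA f g h))
    (fun A B D g => @lcomp_linearl C D B A g)
    (fun A B D f => @lcomp_linearr C D B A f).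

Definition is_zero_object (C : lcat) (Z : C) : Prop :=
  forall A : C, (forall f : lhom Z A, f = 0) /\ (forall f : lhom A Z, f = 0).

Definition is_biproduct (C : lcat) (A B P : C) : Prop :=
  exists (i1 : lhom A P) (i2 : lhom B P) (p1 : lhom P A) (p2 : lhom P B),
    [/\ lcomp p1 i1 = lid A, lcomp p2 i2 = lid B,
        lcomp p1 i2 = 0, lcomp p2 i1 = 0
      & lcomp i1 p1 + lcomp i2 p2 = lid P].

Definition additive_cat (C : lcat) : Prop :=
  (exists Z : C, is_zero_object Z) /\
  (forall A B : C, exists P : C, is_biproduct A B P).

Definition idempotents_split (C : lcat) : Prop :=
  forall (A : C) (e : lhom A A), lcomp e e = e ->
    exists (B : C) (p : lhom A B) (i : lhom B A),
      lcomp i p = e /\ lcomp p i = lid B.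

Definition hom_finite_variety (C : lcat) : Prop :=
  [/\ additive_cat C, idempotents_split C & forall A B : C, fin_gen (lhom A B)].

Record lfunctor (C D : lcat) := LFunctor {
  lfobj :> C -> D;
  lfmap : forall A B, lhom A B -> lhom (lfobj A) (lfobj B);
  lfmap_linear : forall A B, linear (@lfmap A B);
  lfmap_id : forall A, lfmap (lid A) = lid (lfobj A);
  lfmap_comp : forall A B X (g : lhom B X) (f : lhom A B),
    lfmap (lcomp g f) = lcomp (lfmap g) (lfmap f) }.

Definition op_lfunctor (C D : lcat) (F : lfunctor C D) :
    lfunctor (op_lcat C) (op_lcat D) :=
  @LFunctor (op_lcat C) (op_lcat D) (lfobj F) (fun A B f => lfmap F f)
    (fun A B => @lfmap_linear _ _ F B A) (lfmap_id F)
    (fun A B X g f => lfmap_comp F f g).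

(* An additive functor from an R-linear category to abelian groups takes values
   in R-modules, with [a] acting on M(A) through [a *: lid A]; it is the same
   thing as an R-linear functor to R-modules. *)
Record cmod (C : lcat) := CMod {
  mobj :> C -> lmodType R;
  mmap : forall A B, lhom A B -> {linear mobj A -> mobj B};
  mmap_linear : forall A B (x : mobj A),
    linear (fun f : lhom A B => mmap f x);
  mmap_id : forall A (x : mobj A), mmap (lid A) x = x;
  mmap_comp : forall A B X (g : lhom B X) (f : lhom A B) (x : mobj A),
    mmap (lcomp g f) x = mmap g (mmap f x) }.

Record nattr (C : lcat) (M N : cmod C) := NatTr {
  ntmap :> forall A : C, {linear M A -> N A};
  ntmap_nat : forall (A B : C) (f : lhom A B) (x : M A),
    ntmap B (mmap M f x) = mmap N f (ntmap A x) }.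

Lemma nattr_ext (C : lcat) (M N : cmod C) (a b : nattr M N) :
  (forall (A : C) (x : M A), a A x = b A x) -> a = b.
Proof.
case: a b => [a na] [b nb] /= ab.
have E : a = b.
  by apply: functional_extensionality_dep => A; apply: linear_ext => x; apply: ab.
by case: b / E nb {ab} => nb; rewrite (Prop_irrelevance na nb).
Qed.

Program Definition nattr_id (C : lcat) (M : cmod C) : nattr M M :=
  @NatTr C M M (fun A => idfun : {linear M A -> M A}) _.
Next Obligation. by move=> C M A B f x. Qed.

Program Definition nattr_comp (C : lcat) (M N P : cmod C)
    (b : nattr N P) (a : nattr M N) : nattr M P :=
  @NatTr C M P (fun A => (b A \o a A) : {linear M A -> P A}) _.
Next Obligation. by move=> C M N P b a A B f x /=; rewrite !ntmap_nat. Qed.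

Program Definition Mod (C : lcat) : category :=
  @Category (cmod C) (@nattr C) (@nattr_id C) (@nattr_comp C) _ _ _.
Next Obligation. by move=> *; apply: nattr_ext. Qed.
Next Obligation. by move=> *; apply: nattr_ext. Qed.
Next Obligation. by move=> *; apply: nattr_ext. Qed.

(* Exactness in Mod(C) is computed objectwise. *)
Definition nt_epi (C : lcat) (M N : cmod C) (p : nattr M N) : Prop :=
  forall (A : C) (y : N A), exists x : M A, p A x = y.

Definition nt_exact (C : lcat) (L M N : cmod C)
    (a : nattr L M) (p : nattr M N) : Prop :=
  forall (A : C) (x : M A), p A x = 0 <-> exists y : L A, a A y = x.

Section Representable.
Variables (C : lcat) (X : C).

Definition rep_map (A B : C) (f : lhom A B) : lhom X A -> lhom X B :=
  fun g => lcomp f g.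
HB.instance Definition _ A B (f : lhom A B) :=
  GRing.isLinear.Build R (lhom X A) (lhom X B) *:%R (rep_map f)
    (@lcomp_linearr C X A B f).

(* The functor Hom_C(X,-); Hom_C(-,X) is [rep] of X in [op_lcat C]. *)
Program Definition rep : cmod C :=
  @CMod C (fun A => lhom X A) (fun A B f => rep_map f) _ _ _.
Next Obligation. move=> A B x; exact: lcomp_linearl. Qed.
Next Obligation. move=> A x; exact: lidl. Qed.
Next Obligation. by move=> A B Y g f x; rewrite /= /rep_map lcompA. Qed.

End Representable.

Definition fin_pres (C : lcat) (M : cmod C) : Prop :=
  exists (C0 C1 : C) (a : nattr (rep C0) (rep C1)) (p : nattr (rep C1) M),
    nt_exact a p /\ nt_epi p.

Definition fpmod (C : lcat) : category := @full_subcat (Mod C) (@fin_pres C).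

Section Pullback.
Variables (C D : lcat) (F : lfunctor C D).

Program Definition pullback_obj (M : cmod D) : cmod C :=
  @CMod C (fun A => M (F A)) (fun A B f => mmap M (lfmap F f)) _ _ _.
Next Obligation.
move=> M A B x a f g.
by rewrite lfmap_linear (mmap_linear x).
Qed.
Next Obligation. by move=> M A x; rewrite /= lfmap_id mmap_id. Qed.
Next Obligation. by move=> M A B X g f x; rewrite /= lfmap_comp mmap_comp. Qed.

Program Definition pullback_map (M N : cmod D) (a : nattr M N) :
    nattr (pullback_obj M) (pullback_obj N) :=
  @NatTr C (pullback_obj M) (pullback_obj N) (fun A => a (F A)) _.
Next Obligation. by move=> M N a A B f x; exact: (ntmap_nat a (lfmap F f) x). Qed.

Program Definition pullback : functor (Mod D) (Mod C) :=
  @Functor (Mod D) (Mod C) pullback_obj pullback_map _ _.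
Next Obligation. by move=> A; apply: nattr_ext. Qed.
Next Obligation. by move=> *; apply: nattr_ext. Qed.

End Pullback.

Section Duality.
Variables (E : lmodType R) (C : lcat).

Program Definition dual_obj (M : cmod C) : cmod (op_lcat C) :=
  @CMod (op_lcat C) (fun A => homR (M A) E)
    (fun A B f => @precomp R (M B) (M A) E (mmap M f)) _ _ _.
Next Obligation.
move=> M A B x a f g; apply: linear_ext => y /=.
by rewrite (mmap_linear y) linearP.
Qed.
Next Obligation. by move=> M A x; apply: linear_ext => y /=; rewrite mmap_id. Qed.
Next Obligation.
by move=> M A B X g f x; apply: linear_ext => y /=; rewrite mmap_comp.
Qed.

Program Definition dual_map (M N : cmod C) (a : nattr M N) :
    nattr (dual_obj N) (dual_obj M) :=
  @NatTr (op_lcat C) (dual_obj N) (dual_obj M)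
    (fun A => @precomp R (M A) (N A) E (a A)) _.
Next Obligation.
by move=> M N a A B f x; apply: linear_ext => y /=; rewrite ntmap_nat.
Qed.

(* Hom_R(-,E) is defined here on all of Mod(C), not only on the functors with
   finitely generated values; over a Hom-finite C, finitely presented functors
   have finitely generated values, so the restriction to mod(C) is the same. *)
Program Definition dual : functor (op_cat (Mod C)) (Mod (op_lcat C)) :=
  @Functor (op_cat (Mod C)) (Mod (op_lcat C)) dual_obj
    (fun M N a => dual_map a) _ _.
Next Obligation.
by move=> M; apply: nattr_ext => A x; apply: linear_ext.
Qed.
Next Obligation.
by move=> M N P b a; apply: nattr_ext => A x; apply: linear_ext.
Qed.

Definition dual_preserves_fp : Prop :=
  forall M : cmod C, fin_pres M -> fin_pres (dual_obj M).

Definition fp_dual (h : dual_preserves_fp) :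
    functor (op_cat (fpmod C)) (fpmod (op_lcat C)) :=
  @restrict_cofunctor (Mod C) (Mod (op_lcat C)) _ _ dual h.

Definition dualizing : Prop :=
  hom_finite_variety C /\
  exists h : dual_preserves_fp, is_equivalence (fp_dual h).

End Duality.

Definition pullback_preserves_fp (C D : lcat) (F : lfunctor C D) : Prop :=
  forall M : cmod D, fin_pres M -> fin_pres (pullback_obj F M).

Definition fp_pullback (C D : lcat) (F : lfunctor C D)
    (h : pullback_preserves_fp F) : functor (fpmod D) (fpmod C) :=
  @restrict_functor (Mod D) (Mod C) _ _ (pullback F) h.

Record ideal (C : lcat) := Ideal {
  imem :> forall A B : C, zmodClosed (lhom A B);
  ideal_compl : forall A B X (g : lhom B X) (f : lhom A B),
    f \in imem A B -> lcomp g f \in imem A X;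
  ideal_compr : forall A B X (g : lhom B X) (f : lhom A B),
    g \in imem B X -> lcomp g f \in imem A X }.

Definition op_ideal (C : lcat) (I : ideal C) : ideal (op_lcat C) :=
  @Ideal (op_lcat C) (fun A B => imem I B A)
    (fun A B X g f => @ideal_compr C I X B A f g)
    (fun A B X g f => @ideal_compl C I X B A f g).

Section Quotient.
Variables (C : lcat) (I : ideal C).

Definition ipred (A B : C) : {pred lhom A B} := fun f => f \in I A B.

Lemma lcompBl (A B X : C) (g h : lhom B X) (f : lhom A B) :
  lcomp (g - h) f = lcomp g f - lcomp h f.
Proof. by rewrite -!scaleN1r addrC (lcomp_linearl f) addrC. Qed.
Lemma lcompBr (A B X : C) (g : lhom B X) (f h : lhom A B) :
  lcomp g (f - h) = lcomp g f - lcomp g h.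
Proof. by rewrite -!scaleN1r addrC (lcomp_linearr g) addrC. Qed.
Lemma lcompZl (A B X : C) a (g : lhom B X) (f : lhom A B) :
  lcomp (a *: g) f = a *: lcomp g f.
Proof.
have lcomp0 : lcomp 0 f = 0 :> lhom A X.
  by rewrite -(subrr (0 : lhom B X)) lcompBl subrr.
by rewrite -{1}[a *: g]addr0 (lcomp_linearl f) lcomp0 addr0.
Qed.

(* The subgroups I(A,B) are submodules, since a *: f = (a *: lid) o f. *)
Lemma ipred_submod_closed A B : submod_closed (@ipred A B).
Proof.
have E f : (f \in @ipred A B) = (f \in I A B) by [].
split => [|a f g]; rewrite !E ?rpred0 // => If Ig; apply: rpredD => //.
by rewrite -[f]lidl -lcompZl; apply: ideal_compl.
Qed.
HB.instance Definition _ A B :=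
  GRing.isSubmodClosed.Build R (lhom A B) (@ipred A B)
    (GRing.submod_closed_semi (@ipred_submod_closed A B)).

Definition isub (A B : C) : submodClosed (lhom A B) := @ipred A B.

Definition quo_hom (A B : C) : lmodType R := quolmod (isub A B).

Definition quo_cls (A B : C) (f : lhom A B) : quo_hom A B := quo_pi (isub A B) f.

Lemma quo_clsP A B (f g : lhom A B) : quo_cls f = quo_cls g <-> f - g \in I A B.
Proof. exact: quo_piE. Qed.

Definition quo_comp (A B X : C) (g : quo_hom B X) (f : quo_hom A B) :
    quo_hom A X :=
  quo_cls (lcomp (quo_repr g) (quo_repr f)).

Lemma quo_homP A B (f : quo_hom A B) : exists f0, f = quo_cls f0.
Proof. by exists (quo_repr f); rewrite /quo_cls quo_reprK. Qed.

Lemma quo_comp_cls A B X (g : lhom B X) (f : lhom A B) :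
  quo_comp (quo_cls g) (quo_cls f) = quo_cls (lcomp g f).
Proof.
set g' := quo_repr (quo_cls g); set f' := quo_repr (quo_cls f).
have Ig : g' - g \in I B X by apply/quo_clsP; exact: quo_reprK.
have If : f' - f \in I A B by apply/quo_clsP; exact: quo_reprK.
apply/quo_clsP; rewrite -/g' -/f'.
have -> : lcomp g' f' - lcomp g f = lcomp (g' - g) f' + lcomp g (f' - f).
  by rewrite lcompBl lcompBr addrA addrNK.
by apply: rpredD; [apply: ideal_compr | apply: ideal_compl].
Qed.

Lemma quo_cls_linear A B : linear (@quo_cls A B).
Proof. exact: linearP. Qed.

Program Definition quo_lcat : lcat :=
  @LCat C quo_hom (fun A => quo_cls (lid A)) quo_comp _ _ _ _ _.
Next Obligation.
by move=> A B f; have [f0 ->] := quo_homP f; rewrite quo_comp_cls lidl.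
Qed.
Next Obligation.
by move=> A B f; have [f0 ->] := quo_homP f; rewrite quo_comp_cls lidr.
Qed.
Next Obligation.
move=> A B X Y h g f; have [f0 ->] := quo_homP f; have [g0 ->] := quo_homP g.
by have [h0 ->] := quo_homP h; rewrite !quo_comp_cls lcompA.
Qed.
Next Obligation.
move=> A B X g a f h; have [f0 ->] := quo_homP f; have [g0 ->] := quo_homP g.
have [h0 ->] := quo_homP h.
by rewrite -quo_cls_linear !quo_comp_cls (lcomp_linearr g0) quo_cls_linear.
Qed.
Next Obligation.
move=> A B X f a g h; have [f0 ->] := quo_homP f; have [g0 ->] := quo_homP g.
have [h0 ->] := quo_homP h.
by rewrite -quo_cls_linear !quo_comp_cls (lcomp_linearl f0) quo_cls_linear.
Qed.

Program Definition quo_functor : lfunctor C quo_lcat :=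
  @LFunctor C quo_lcat (fun A => A) (fun A B f => quo_cls f) _ _ _.
Next Obligation. move=> A B; exact: quo_cls_linear. Qed.
Next Obligation. by []. Qed.
Next Obligation. by move=> A B X g f; rewrite /= quo_comp_cls. Qed.

Section RepresentableIdeal.
Variable X : C.

Definition isub_rep (A : C) : Type := sublmod (isub X A).
HB.instance Definition _ A := GRing.Lmodule.on (isub_rep A).

Definition irep_map (A B : C) (f : lhom A B) (g : isub_rep A) : isub_rep B :=
  exist _ (lcomp f (val g)) (ideal_compl f (valP g)).

Lemma irep_map_linear A B (f : lhom A B) : linear (irep_map f).
Proof. by move=> a g h; apply: val_inj; rewrite /= (lcomp_linearr f). Qed.
HB.instance Definition _ A B (f : lhom A B) :=
  GRing.isLinear.Build R (isub_rep A) (isub_rep B) *:%R (irep_map f)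
    (irep_map_linear f).

(* The subfunctor I(X,-) of Hom_C(X,-). *)
Program Definition irep : cmod C :=
  @CMod C (fun A => isub_rep A) (fun A B f => irep_map f) _ _ _.
Next Obligation.
by move=> A B x a f g; apply: val_inj; rewrite /= (lcomp_linearl (val x)).
Qed.
Next Obligation. by move=> A x; apply: val_inj; rewrite /= lidl. Qed.
Next Obligation.
by move=> A B Y g f x; apply: val_inj; rewrite /= lcompA.
Qed.

End RepresentableIdeal.

End Quotient.

(* I(-,X) is the functor [irep] of the opposite ideal, and a functor on C^op. *)
Definition property_A (C : lcat) (I : ideal C) : Prop :=
  forall X : C,
    (exists (Y : C) (p : nattr (rep Y) (irep I X)), nt_epi p) /\
    (exists (Y : op_lcat C)
            (p : nattr (rep Y) (irep (op_ideal I) (X : op_lcat C))), nt_epi p).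

End LinearCategories.

(* Main.v *)
From HB Require Import structures.
Require Import Defs.
From mathcomp Require Import all_boot all_algebra.
From mathcomp Require Import boolp.

(** Write pi : C -> C/I for the projection. Everything is transported along the
    pullback functors M |-> M o pi and N |-> N o pi^op, with which Hom_R(-,E)
    visibly commutes.

    Finite presentation passes through pi in both directions. By Yoneda, a
    presentation of M is an element m of some M(C1) that generates M, together
    with a morphism a out of C1 such that f kills m exactly when f factors
    through a. Since pi is full and bijective on objects, data that
    present M o pi over C present M over C/I ([fin_pres_descends]). Conversely a
    presentation over C/I lifts to C once the morphisms of I out of C1 are added
    to the relations; property (A) says that these are the multiples of a single
    t in I, so the biproduct of the targets of a and t gives a presentation of
    M o pi ([pullback_fp]). Hence duality preserves finite presentation over
    C/I: the dual of M, pulled back to C^op, is the dual of M o pi.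

    The duality of C/I is an equivalence because it is fully faithful and
    essentially surjective. Pullback is fully faithful, so the first property is
    inherited from C. For the second, let N be finitely presented over
    (C/I)^op, and let M be a finitely presented functor on C whose dual is
    isomorphic to N o pi^op. The dual of M is then killed by I, and so is M:
    faithfulness of the duality of C on maps from representable functors shows
    that the linear forms into E separate the elements of M(B)
    ([dual_faithful_cogenerates]). So M is of the form M' o pi, and the dual of
    M' is isomorphic to N.

    That C/I is again a Hom-finite variety is immediate, except for the
    splitting of idempotents. An idempotent of End(A)/I(A,A) lifts to End(A)
    because a finitely generated algebra over an artinian ring is strongly
    pi-regular: x^k = x^(2k) y for some k > 0 and some y commuting with x. Then
    x^k y is idempotent, and it is congruent to x modulo I whenever x^2 is
    ([idempotent_lift]). *)

Set Implicit Arguments.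
Unset Strict Implicit.
Unset Printing Implicit Defensive.

Import GRing.Theory.
Local Open Scope ring_scope.

(** * Equivalences of categories *)

Section Equivalence.
Variables K L : category.
Implicit Type F : functor K L.

Definition iso (X Y : K) : Prop :=
  exists (u : mor X Y) (v : mor Y X), compc v u = idc X /\ compc u v = idc Y.

Definition faithful F : Prop :=
  forall A B (f g : mor A B), fmap F f = fmap F g -> f = g.

Definition full F : Prop :=
  forall A B (h : mor (F A) (F B)), exists f : mor A B, fmap F f = h.

End Equivalence.

Definition ess_surjective (K L : category) (F : functor K L) : Prop :=
  forall B : L, exists A : K, iso (F A) B.

(** A left inverse [G] of [F] up to isomorphism recovers a morphism [h] from
    [F h]: conjugating [G (F h)] by the isomorphism gives [h] back. *)
Lemma iso_id_faithful (K L : category) (F : functor K L) (G : functor L K) :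
  nat_iso (comp_functor G F) (id_functor K) -> faithful F.
Proof.
move=> [a [b [na _ ab]]] A B f g Ffg.
have recover h : h = compc (a B) (compc (fmap G (fmap F h)) (b A)).
  by rewrite compcA (na A B h) -compcA (ab A) /= idcr.
by rewrite (recover f) (recover g) Ffg.
Qed.

Lemma equivalence_faithful (K L : category) (F : functor K L) :
  is_equivalence F -> faithful F.
Proof. by move=> [G [GF _]]; apply: iso_id_faithful GF. Qed.

Lemma equivalence_full (K L : category) (F : functor K L) :
  is_equivalence F -> full F.
Proof.
move=> [G [[a [b [na ba ab]]] FG]] A B h.
exists (compc (a B) (compc (fmap G h) (b A))).
(* [G] is faithful as well, so it is enough to compare [G (F f)] with [G h]. *)
apply: (iso_id_faithful FG); set f := (X in fmap F X).
have E : compc (a B) (fmap G (fmap F f)) = compc (a B) (fmap G h).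
  by rewrite (na A B f) /= -!compcA (ba A) /= idcr.
by rewrite -[LHS]idcl -[RHS]idcl -(ba B) /= -!compcA E.
Qed.

Lemma equivalence_ess_surjective (K L : category) (F : functor K L) :
  is_equivalence F -> ess_surjective F.
Proof.
move=> [G [_ [a [b [_ ba ab]]]]] B; exists (G B).
by exists (a B), (b B); split; [apply: ba | apply: ab].
Qed.

Lemma equivalence_of_full_faithful (K L : category) (F : functor K L) :
  full F -> faithful F -> ess_surjective F -> is_equivalence F.
Proof.
move=> fullF faithF essF.
have inv B : {A : K & {u : mor (F A) B & {v : mor B (F A) |
    compc v u = idc (F A) /\ compc u v = idc B}}}.
  by have [A /cid[u /cid uv]] := cid (essF B); exists A, u.
pose g0 B := projT1 (inv B).
pose u B : mor (F (g0 B)) B := projT1 (projT2 (inv B)).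
pose v B : mor B (F (g0 B)) := sval (projT2 (projT2 (inv B))).
have vu B : compc (v B) (u B) = idc (F (g0 B)).
  by case: (svalP (projT2 (projT2 (inv B)))).
have uv B : compc (u B) (v B) = idc B.
  by case: (svalP (projT2 (projT2 (inv B)))).
pose t A B (h : mor (F A) (F B)) := sval (cid (fullF A B h)).
have tE A B h : fmap F (@t A B h) = h by rewrite /t; case: cid.
pose gm B B' (f : mor B B') := t (g0 B) (g0 B') (compc (v B') (compc f (u B))).
have gm_id B : gm B B (idc B) = idc (g0 B).
  by apply: faithF; rewrite tE idcl vu fmap_id.
have gm_comp A B X (g : mor B X) (f : mor A B) :
    gm A X (compc g f) = compc (gm B X g) (gm A B f).
  apply: faithF; rewrite fmap_comp !tE -!compcA; congr compc.
  by congr compc; rewrite (compcA (u B)) uv idcl.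
exists (@Functor L K g0 gm gm_id gm_comp); split.
  exists (fun A => t _ _ (u (F A))), (fun A => t _ _ (v (F A))); split=> /=.
  - move=> A B f; apply: faithF; rewrite !fmap_comp !tE.
    by rewrite compcA uv idcl.
  - by move=> A; apply: faithF; rewrite fmap_comp !tE vu fmap_id.
  - by move=> A; apply: faithF; rewrite fmap_comp !tE uv fmap_id.
exists u, v; split=> //= A B f.
by rewrite tE compcA uv idcl.
Qed.

(** * Equality of functors *)

Definition mor_cast (K : category) (A A' B B' : K) (eA : A = A') (eB : B = B')
    (f : mor A B) : mor A' B' :=
  ecast X (mor A' X) eB (ecast X (mor X B) eA f).

(** Equality on objects is given as data, so that the values on morphisms can be
    compared after transport along it. *)
Lemma functor_ext (K L : category) (F G : functor K L)
    (e : forall A, F A = G A) :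
  (forall A B (f : mor A B), mor_cast (e A) (e B) (fmap F f) = fmap G f) ->
  F = G.
Proof.
case: F G e => [F0 F1 Fi Fc] [G0 G1 Gi Gc] /= e.
have E : F0 = G0 by apply/functional_extensionality_dep.
case: G0 / E G1 Gi Gc e => G1 Gi Gc e E.
have {E} E : F1 = G1.
  do 3![apply: functional_extensionality_dep => ?].
  by rewrite -E !(Prop_irrelevance (e _) erefl).
case: G1 / E Gi Gc => Gi Gc.
by rewrite (Prop_irrelevance Fi Gi) (Prop_irrelevance Fc Gc).
Qed.

(** * Descending chains in finitely generated modules *)

Section LeadingIdeal.
Variables (R : comPzRingType) (V : lmodType R) (n : nat) (v : 'I_n -> V).

(** The coefficients at [v i] of the elements of [J] that lie in the span of
    [v 0], ..., [v i]. These ideals play the part that leading coefficients play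
    in the proof of Hilbert's basis theorem. *)
Definition lead (J : submodClosed V) (i : 'I_n) : {pred R^o} :=
  fun a => `[< exists c : 'I_n -> R,
    \sum_(j < n | (j < i)%N) c j *: v j + (a : R) *: v i \in J >].

Lemma lead_submod_closed J i : submod_closed (lead J i).
Proof.
split.
  apply/asboolP; exists (fun=> 0); rewrite scale0r addr0 big1 ?rpred0 // => j _.
  by rewrite scale0r.
move=> r a b /asboolP[c cJ] /asboolP[d dJ]; apply/asboolP.
exists (fun j => r * c j + d j).
have -> : \sum_(j < n | (j < i)%N) (r * c j + d j) *: v j +
    (r *: a + b : R) *: v i =
    r *: (\sum_(j < n | (j < i)%N) c j *: v j + (a : R) *: v i) +
    (\sum_(j < n | (j < i)%N) d j *: v j + (b : R) *: v i).
  rewrite scalerDr scaler_sumr addrACA -big_split /= scalerDl scalerA.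
  by congr (_ + _); apply: eq_bigr => j _; rewrite scalerDl scalerA.
by rewrite rpredD ?rpredZ.
Qed.
HB.instance Definition _ J i := GRing.isSubmodClosed.Build R R^o (lead J i)
  (GRing.submod_closed_semi (lead_submod_closed J i)).

(** By induction on [k], an element of [J] in the span of the first [k]
    generators lies in [K]: subtracting an element of [K] with the same last
    coefficient leaves an element of [J] in the span of one generator fewer. *)
Lemma lead_eq (J K : submodClosed V) :
  {subset K <= J} -> (forall i, lead J i =i lead K i) ->
  (forall x, exists c : 'I_n -> R, x = \sum_(i < n) c i *: v i) -> J =i K.
Proof.
move=> KJ JK gen x; apply/idP/idP; last exact: KJ.
suff main k : forall c : 'I_n -> R,
    \sum_(j < n | (j < k)%N) c j *: v j \in J ->
    \sum_(j < n | (j < k)%N) c j *: v j \in K.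
  have [c ->] := gen x; have := main n c.
  by rewrite (eq_bigl xpredT) // => j; rewrite ltn_ord.
elim: k => [|k IH] c; first by rewrite big1 ?rpred0.
have [kn | nk] := ltnP k n; last first.
  have E : (fun j : 'I_n => (j < k.+1)%N) =1 (fun j => (j < k)%N).
    by move=> j; rewrite !(leq_trans (ltn_ord j)) // ltnW.
  by rewrite !(eq_bigl _ _ E); apply: IH.
pose i := Ordinal kn.
have split d : \sum_(j < n | (j < k.+1)%N) d j *: v j =
    \sum_(j < n | (j < k)%N) d j *: v j + d i *: v i.
  rewrite (bigD1 i) //= addrC; congr (_ + _); apply: eq_bigl => j.
  by rewrite ltnS ltn_neqAle andbC.
rewrite split => cJ.
have : (c i : R^o) \in lead J i by apply/asboolP; exists c.
rewrite JK => /asboolP[d dK].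
set x0 := _ + _; set y := _ + _ in dK; rewrite -[x0](subrK y).
have E : x0 - y = \sum_(j < n | (j < k)%N) (c j - d j) *: v j.
  rewrite /x0 /y opprD addrACA subrr addr0 -sumrB.
  by apply: eq_bigr => j _; rewrite scalerBl.
apply: rpredD => //; rewrite E; apply: IH; rewrite -E.
by rewrite -scaleN1r rpredD // rpredZ // KJ.
Qed.

End LeadingIdeal.

(** For each of the finitely many [i] the chain of ideals [lead v (J k) i] is
    stationary, and these ideals determine the submodule by [lead_eq]. *)
Lemma artinian_fin_gen_dcc (R : comPzRingType) (V : lmodType R) :
  artinian R -> fin_gen V -> forall J : nat -> submodClosed V,
  (forall k, {subset J k.+1 <= J k}) ->
  exists N, forall m, (N <= m)%N -> J m =i J N.
Proof.
move=> artR [n [v gen]] J decJ.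
have decJ' k m : (k <= m)%N -> {subset J m <= J k}.
  elim: m => [|m IH]; first by rewrite leqn0 => /eqP ->.
  by rewrite leq_eqVlt => /predU1P[-> // | /IH km] x /decJ /km.
have /choice [N NP] : forall i : 'I_n, exists N, forall m, (N <= m)%N ->
    lead v (J m) i =i lead v (J N) i.
  move=> i; apply: (artR (fun k => lead v (J k) i : submodClosed R^o)).
  by move=> k a /asboolP[c /decJ cJ]; apply/asboolP; exists c.
exists (\max_i N i)%N => m Nm x; apply/esym; move: x.
apply: (lead_eq (v := v)) => // [|i a]; first exact: decJ'.
rewrite (NP i (\max_i N i)) ?(leq_bigmax i) //.
by rewrite (NP i m) // (leq_trans _ Nm) // (leq_bigmax i).
Qed.

(** * Linear categories and the Yoneda lemma *)

Section Linear.
Variable R : comPzRingType.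
Implicit Types C D : lcat R.

Lemma lcompDl C (A B X : C) (g h : lhom B X) (f : lhom A B) :
  lcomp (g + h) f = lcomp g f + lcomp h f.
Proof. by rewrite -[g]scale1r lcomp_linearl !scale1r. Qed.

Lemma lcompDr C (A B X : C) (g : lhom B X) (f h : lhom A B) :
  lcomp g (f + h) = lcomp g f + lcomp g h.
Proof. by rewrite -[f]scale1r lcomp_linearr !scale1r. Qed.

Lemma lcomp0r C (A B X : C) (g : lhom B X) : lcomp g (0 : lhom A B) = 0.
Proof. by rewrite -(subrr 0) lcompBr subrr. Qed.

Lemma lcomp0l C (A B X : C) (f : lhom A B) : lcomp (0 : lhom B X) f = 0.
Proof. by rewrite -(subrr 0) lcompBl subrr. Qed.

Section LFunctor.
Variables (C D : lcat R) (F : lfunctor C D) (A B : C).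

HB.instance Definition _ := GRing.isLinear.Build R (lhom A B)
  (lhom (F A) (F B)) *:%R (@lfmap R C D F A B) (@lfmap_linear R C D F A B).

Lemma lfmapD (f g : lhom A B) : lfmap F (f + g) = lfmap F f + lfmap F g.
Proof. exact: linearD. Qed.

Lemma lfmap0 : lfmap F (0 : lhom A B) = 0.
Proof. exact: linear0. Qed.

Lemma lfmapB (f g : lhom A B) : lfmap F (f - g) = lfmap F f - lfmap F g.
Proof. exact: linearB. Qed.

End LFunctor.

Section CMod.
Variables (C : lcat R) (M : cmod C) (A B : C) (x : M A).

Lemma mmapD (f g : lhom A B) : mmap M (f + g) x = mmap M f x + mmap M g x.
Proof. by rewrite -[f]scale1r (mmap_linear x) !scale1r. Qed.

Lemma mmap0 : mmap M (0 : lhom A B) x = 0.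
Proof. by apply: (addrI (mmap M (0 : lhom A B) x)); rewrite -mmapD !addr0. Qed.

Lemma mmapB (f g : lhom A B) : mmap M (f - g) x = mmap M f x - mmap M g x.
Proof. by apply: (addIr (mmap M g x)); rewrite -mmapD !subrK. Qed.

End CMod.

Section Yoneda.
Variables (C : lcat R) (M : cmod C) (X : C).

Lemma yonedaE (p : nattr (rep X) M) (A : C) (f : lhom X A) :
  p A f = mmap M f (p X (lid X)).
Proof. by rewrite -ntmap_nat /= /rep_map lidr. Qed.

Variable x : M X.

Definition yoneda_map (A : C) (f : lhom X A) : M A := mmap M f x.
HB.instance Definition _ A := GRing.isLinear.Build R (lhom X A) (M A) *:%R
  (@yoneda_map A) (mmap_linear x).

Lemma yoneda_natural (A B : C) (f : lhom A B) (g : rep X A) :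
  yoneda_map (mmap (rep X) f g) = mmap M f (yoneda_map g).
Proof. exact: mmap_comp. Qed.

Definition yoneda : nattr (rep X) M :=
  @NatTr R C (rep X) M (fun A => @yoneda_map A) yoneda_natural.

End Yoneda.

(** Yoneda turns the two maps of a presentation into elements: [m] generates
    [M], and [a] generates the relations satisfied by [m]. *)
Lemma fin_presP C (M : cmod C) :
  fin_pres M <->
  exists (C0 C1 : C) (a : lhom C1 C0) (m : M C1),
    (forall (A : C) (y : M A), exists f : lhom C1 A, mmap M f m = y) /\
    (forall (A : C) (f : lhom C1 A),
       mmap M f m = 0 <-> exists g : lhom C0 A, lcomp g a = f).
Proof.
split=> [[C0 [C1 [a [p [ex ep]]]]] | [C0 [C1 [a [m [gen rel]]]]]].
  exists C0, C1, (a C0 (lid C0)), (p C1 (lid C1)); split=> [A y | A f].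
    by have [f <-] := ep A y; exists f; rewrite -(yonedaE p).
  rewrite -(yonedaE p) ex.
  split=> -[g <-]; exists g; last exact: (yonedaE a).
  exact/esym/(yonedaE a).
exists C0, C1, (yoneda (M := rep C1) a), (yoneda m); split=> [A f | A y].
  exact: rel.
by have [f <-] := gen A y; exists f.
Qed.

(** The relation is the zero morphism out of [X]. *)
Lemma fin_pres_rep C (X : C) : fin_pres (rep X).
Proof.
apply/fin_presP; exists X, X, 0, (lid X); split=> [A f | A f] /=.
  by exists f; rewrite /rep_map lidr.
rewrite /rep_map lidr; split=> [-> | [g <-]]; last by rewrite lcomp0r.
by exists 0; rewrite lcomp0r.
Qed.

(** * Quotient functors and finitely presented functors *)

(** A full functor bijective on objects. Bijectivity is encoded as a dependent
    eliminator with its computation rule: a family indexed by the objects of [D]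
    can be defined on the values [F A], and no transport along an equality of
    objects is ever needed. Unlike the projection onto a quotient by an ideal,
    this notion is literally self-dual, which lets each lemma below serve for
    [C] and for its opposite. *)
Record quotient_functor C D (F : lfunctor C D) := QuotientFunctor {
  qrect : forall P : D -> Type, (forall A : C, P (F A)) -> forall B, P B;
  qrectE : forall P h A, @qrect P h (F A) = h A;
  qfull : forall (A B : C) (g : lhom (F A) (F B)),
    exists f : lhom A B, lfmap F f = g }.

Definition op_quotient_functor C D (F : lfunctor C D)
    (qF : quotient_functor F) : quotient_functor (op_lfunctor F) :=
  @QuotientFunctor (op_lcat C) (op_lcat D) (op_lfunctor F)
    (qrect qF) (qrectE qF) (fun A B g => qfull qF g).

Lemma qind C D (F : lfunctor C D) (qF : quotient_functor F) (P : D -> Prop) :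
  (forall A : C, P (F A)) -> forall B, P B.
Proof. exact: (qrect qF). Qed.

(** One half of property (A), read through Yoneda: the ideal of morphisms killed
    by [F] is, on the morphisms out of [X], generated by one element. The other
    half is this statement for [op_lfunctor F]. *)
Definition kernel_generated C D (F : lfunctor C D) : Prop :=
  forall X : C, exists (Y : C) (t : lhom X Y),
    lfmap F t = 0 /\
    forall (A : C) (f : lhom X A), lfmap F f = 0 -> exists g, f = lcomp g t.

Lemma additive_op C : additive_cat C -> additive_cat (op_lcat C).
Proof.
move=> [[Z zZ] bi]; split.
  by exists Z => A; have [? ?] := zZ A.
move=> A B; have [P [i1 [i2 [p1 [p2 [e11 e22 e12 e21 e]]]]]] := bi A B.
by exists P, p1, p2, i1, i2.
Qed.

Section FinitePresentation.
Variables (C D : lcat R) (F : lfunctor C D) (qF : quotient_functor F).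

(** The generator of the pullback and the image under [F] of its relation
    present [M]. *)
Lemma fin_pres_descends (M : cmod D) :
  fin_pres (pullback_obj F M) -> fin_pres M.
Proof.
move=> /fin_presP [C0 [C1 [a [m [gen rel]]]]].
apply/fin_presP; exists (F C0), (F C1), (lfmap F a), m.
split; apply: (qind qF) => A; first move=> y.
  by have [f <-] := gen A y; exists (lfmap F f).
move=> f; have [f0 <-] := qfull qF f; split=> [/rel[g <-] | [g gE]].
  by exists (lfmap F g); rewrite lfmap_comp.
have [g0 g0E] := qfull qF g; rewrite -gE -g0E -lfmap_comp.
by apply/rel; exists g0.
Qed.

(** A morphism [f] out of [C1] kills [m] iff [F f] is a multiple of [F a], iff
    [f] is the sum of a multiple of [a] and a multiple of the generator [t] of
    the kernel, iff [f] factors through the morphism [(a, t)] to the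
    biproduct. *)
Lemma pullback_fp : additive_cat C -> kernel_generated F ->
  pullback_preserves_fp F.
Proof.
move=> [_ biC] kerF M /fin_presP [C0' [C1' [a' [m' H]]]].
move: C1' C0' a' m' H; apply: (qind qF) => C1; apply: (qind qF) => C0.
move=> a' m; have [a <-] := qfull qF a'; move=> [gen rel].
have [Y [t [Ft0 tP]]] := kerF C1.
have [P [i1 [i2 [p1 [p2 [e11 e22 e12 e21 _]]]]]] := biC C0 Y.
apply/fin_presP; exists P, C1, (lcomp i1 a + lcomp i2 t), m; split=> A.
  move=> y; have [f' fy] := gen (F A) y; have [f fE] := qfull qF f'.
  by exists f; rewrite /= fE.
move=> f; rewrite /= rel; split=> [[g' gE] | [k <-]].
  have [g gF] := qfull qF g'.
  have /tP [h hE] : lfmap F (f - lcomp g a) = 0.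
    by rewrite lfmapB lfmap_comp gF gE subrr.
  exists (lcomp g p1 + lcomp h p2).
  rewrite lcompDr !lcompDl !lcompA -!(lcompA _ p1) -!(lcompA _ p2).
  rewrite e11 e22 e12 e21 !lcomp0r !lcomp0l !lidr addr0 add0r -hE.
  by rewrite addrC subrK.
exists (lfmap F (lcomp k i1)).
rewrite lcompDr lfmapD !lcompA !(lfmap_comp _ _ t) (lfmap_comp _ _ a).
by rewrite Ft0 lcomp0r addr0.
Qed.

(** Pullback is a full functor: a natural transformation between pullbacks is
    natural for the morphisms of [D], since all of them come from [C]. *)
Section NatDescent.
Variables M N : cmod D.
Variable a : nattr (pullback_obj F M) (pullback_obj F N).

Definition descend_nattr_map : forall B : D, {linear M B -> N B} :=
  qrect qF (P := fun B => {linear M B -> N B}) a.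

Lemma descend_nattr_nat (A B : D) (f : lhom A B) (x : M A) :
  descend_nattr_map B (mmap M f x) = mmap N f (descend_nattr_map A x).
Proof.
move: A B f x; apply: (qind qF) => A; apply: (qind qF) => B f x.
rewrite /descend_nattr_map !qrectE; have [f0 <-] := qfull qF f.
exact: (ntmap_nat a f0 x).
Qed.

Definition descend_nattr : nattr M N := NatTr descend_nattr_nat.

Lemma descend_nattrE (A : C) (x : M (F A)) : descend_nattr (F A) x = a A x.
Proof. by rewrite /= /descend_nattr_map qrectE. Qed.

End NatDescent.

Lemma nattr_ext_quotient (M N : cmod D) (a b : nattr M N) :
  (forall (A : C) (x : M (F A)), a (F A) x = b (F A) x) -> a = b.
Proof. by move=> ab; apply: nattr_ext; apply: (qind qF). Qed.

End FinitePresentation.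

Section Duality.
Variables (E : lmodType R) (C D : lcat R) (F : lfunctor C D).

(** The two functors have the same values and the same action; only the proofs
    of their laws differ. *)
Lemma dual_pullback (M : cmod D) :
  dual_obj E (pullback_obj F M) = pullback_obj (op_lfunctor F) (dual_obj E M).
Proof.
by rewrite /dual_obj /pullback_obj /=; congr CMod; apply: Prop_irrelevance.
Qed.

End Duality.

(** * Idempotents modulo an ideal, and Hom-finite varieties *)

Section Idempotents.
Variables (C : lcat R) (A : C).
Implicit Types x y : lhom A A.

Definition lpow x k := iter k (lcomp x) (lid A).

Lemma lpowD x k m : lpow x (k + m) = lcomp (lpow x k) (lpow x m).
Proof. by elim: k => [|k IH] /=; rewrite ?lidl // IH lcompA. Qed.

Lemma lpow_comm x y k : lcomp x y = lcomp y x ->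
  lcomp (lpow x k) y = lcomp y (lpow x k).
Proof.
move=> xy; elim: k => [|k IH]; first by rewrite /= lidl lidr.
by rewrite /= -lcompA IH lcompA xy lcompA.
Qed.

(** The multiples of [x^k] by elements commuting with [x]. Using the whole
    commutant of [x] in place of the polynomials in [x] still gives a descending
    chain of submodules. *)
Definition pow_commutant x k : {pred lhom A A} :=
  fun z => `[< exists y, lcomp x y = lcomp y x /\ z = lcomp (lpow x k) y >].

Lemma pow_commutant_submod_closed x k : submod_closed (pow_commutant x k).
Proof.
split; first by apply/asboolP; exists 0; rewrite !lcomp0r lcomp0l.
move=> a _ _ /asboolP[y [xy ->]] /asboolP[z [xz ->]]; apply/asboolP.
by exists (a *: y + z); rewrite !lcomp_linearr lcomp_linearl xy xz.
Qed.
HB.instance Definition _ x k := GRing.isSubmodClosed.Build R (lhom A A)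
  (pow_commutant x k)
  (GRing.submod_closed_semi (pow_commutant_submod_closed x k)).

(** The chain [pow_commutant x k] is stationary from some [N] on, and [x^(N+1)]
    belongs to its term of index [N+1], hence to that of index [2(N+1)]. *)
Lemma strongly_pi_regular x : artinian R -> fin_gen (lhom A A) ->
  exists k y, lcomp x y = lcomp y x /\
    lpow x k.+1 = lcomp (lpow x (k.+1 + k.+1)) y.
Proof.
move=> artR fgA.
have [k|N NP] := artinian_fin_gen_dcc artR fgA
  (J := fun k => pow_commutant x k : submodClosed _).
  move=> _ /asboolP[y [xy ->]]; apply/asboolP; exists (lcomp x y).
  rewrite -lcompA xy lcompA; split=> //.
  by rewrite -addn1 lpowD /= lidr -lcompA xy.
have : lpow x N.+1 \in (pow_commutant x N.+1 : submodClosed _).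
  by apply/asboolP; exists (lid A); rewrite !lidr lidl.
rewrite NP // -(NP (N.+1 + N.+1)%N) ?(leq_trans _ (leq_addr _ _)) //.
by move=> /asboolP[y [xy E]]; exists N, y.
Qed.

(** With [k] and [y] as in [strongly_pi_regular] and [p = x^(k+1)], the element
    [e = p y] satisfies [e e = p^2 y y = p y = e]. Since [F x] is idempotent,
    it equals [F p = F (p^2 y) = F x F y = F p F y = F e]. *)
Lemma idempotent_lift D (F : lfunctor C D) x :
  artinian R -> fin_gen (lhom A A) ->
  lcomp (lfmap F x) (lfmap F x) = lfmap F x ->
  exists e : lhom A A, lcomp e e = e /\ lfmap F e = lfmap F x.
Proof.
move=> artR fgA xx; have [k [y [xy pE]]] := strongly_pi_regular x artR fgA.
have Fpow m : lfmap F (lpow x m.+1) = lfmap F x.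
  elim: m => [|m IH]; first by rewrite /= lidr.
  by rewrite [lpow _ _]/= lfmap_comp IH.
exists (lcomp (lpow x k.+1) y); split.
  by rewrite lcompA -(lcompA _ y) -lpow_comm // lcompA -lpowD -pE.
by rewrite lfmap_comp Fpow -(Fpow (k + k.+1)%N) -lfmap_comp -pE Fpow.
Qed.

End Idempotents.

Lemma quotient_variety (C D : lcat R) (F : lfunctor C D) :
  quotient_functor F -> artinian R -> hom_finite_variety C ->
  hom_finite_variety D.
Proof.
move=> qF artR [[[Z zZ] biC] splitC fgC]; split; first split.
- exists (F Z); apply: (qind qF) => A; have [zl zr] := zZ A.
  split=> f; have [f0 <-] := qfull qF f.
    by rewrite (zl f0) lfmap0.
  by rewrite (zr f0) lfmap0.
- apply: (qind qF) => A; apply: (qind qF) => B.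
  have [P [i1 [i2 [p1 [p2 [e11 e22 e12 e21 e]]]]]] := biC A B.
  exists (F P), (lfmap F i1), (lfmap F i2), (lfmap F p1), (lfmap F p2).
  by rewrite -!lfmap_comp -lfmapD e11 e22 e12 e21 e !lfmap0 !lfmap_id.
- apply: (qind qF) => A f; have [x <-] := qfull qF f => xx.
  have [e [ee <-]] := idempotent_lift artR (fgC A A) xx.
  have [B [p [i [ipe pi1]]]] := splitC A e ee.
  exists (F B), (lfmap F p), (lfmap F i).
  by rewrite -!lfmap_comp ipe pi1 lfmap_id.
apply: (qind qF) => A; apply: (qind qF) => B.
have [n [v gen]] := fgC A B; exists n, (fun i => lfmap F (v i)) => f.
have [f0 <-] := qfull qF f; have [c ->] := gen f0; exists c.
by rewrite linear_sum; apply: eq_bigr => i _; rewrite linearZ.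
Qed.

(** * Transfer of the duality along a quotient functor *)

(** The element [y] is a map from the functor represented by [B] to [M]. Its
    dual sends a linear form [psi] on [M X] to [g |-> psi (M g y)]. Each such
    value is that of the linear form [psi o M g] at [y], hence zero, and [y] is
    zero by faithfulness. *)
Lemma dual_faithful_cogenerates (E : lmodType R) C (hC : dual_preserves_fp E C)
    (M : cmod C) (B : C) (y : M B) :
  faithful (fp_dual hC) -> fin_pres M ->
  (forall phi : {linear M B -> E}, phi y = 0) -> y = 0.
Proof.
move=> faithD fpM y0.
pose M' : op_cat (fpmod C) := exist _ M fpM.
pose P' : op_cat (fpmod C) := exist _ (rep B) (fin_pres_rep B).
have := @faithD M' P' (yoneda y) (yoneda 0); rewrite /= => inj.
have {}inj : yoneda y = yoneda 0.
  apply: inj; apply: nattr_ext => A phi; apply: linear_ext => g /=.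
  rewrite /yoneda_map linear0 linear0.
  exact: (y0 (phi \o mmap M g : {linear M B -> E})).
by have := congr1 (fun t : nattr (rep B) M => t B (lid B)) inj;
   rewrite /= /yoneda_map !mmap_id.
Qed.

(** Casting along equalities between functors that differ only in the proofs of
    their laws leaves the components of a natural transformation unchanged. *)
Lemma fpmod_cast C (U V : C -> lmodType R)
    (u : forall A B : C, lhom A B -> {linear U A -> U B})
    (v : forall A B : C, lhom A B -> {linear V A -> V B})
    lu iu cu lu' iu' cu' lv iv cv lv' iv' cv' pU pU' pV pV'
    (eU : exist _ (@CMod R C U u lu iu cu) pU =
          exist _ (@CMod R C U u lu' iu' cu') pU' :> fpmod C)
    (eV : exist _ (@CMod R C V v lv iv cv) pV =
          exist _ (@CMod R C V v lv' iv' cv') pV' :> fpmod C)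
    (t : forall A : C, {linear U A -> V A}) nt nt' :
  mor_cast eU eV (@NatTr R C (CMod lu iu cu) (CMod lv iv cv) t nt) =
  @NatTr R C (CMod lu' iu' cu') (CMod lv' iv' cv') t nt' :> mor _ _.
Proof.
move: pU' pV' eU eV nt'.
case: _ / (Prop_irrelevance lu lu'); case: _ / (Prop_irrelevance iu iu').
case: _ / (Prop_irrelevance cu cu'); case: _ / (Prop_irrelevance lv lv').
case: _ / (Prop_irrelevance iv iv'); case: _ / (Prop_irrelevance cv cv').
move=> pU' pV'; case: _ / (Prop_irrelevance pU pU').
case: _ / (Prop_irrelevance pV pV') => eU eV nt'.
rewrite (Prop_irrelevance eU erefl) (Prop_irrelevance eV erefl).
exact: nattr_ext.
Qed.

Section Transfer.
Variables (E : lmodType R) (C D : lcat R) (F : lfunctor C D).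
Variables (qF : quotient_functor F).
Variables (hC : dual_preserves_fp E C) (hD : dual_preserves_fp E D).
Variables (h1 : pullback_preserves_fp F).
Variables (h2 : pullback_preserves_fp (op_lfunctor F)).

Let pull (M : op_cat (fpmod D)) : op_cat (fpmod C) :=
  exist _ (pullback_obj F (sval M)) (h1 (svalP M)).

(** The duals of [a o F] and [b o F] are the duals of [a] and [b] evaluated at
    the objects [F A]. *)
Lemma dual_faithful_transfer : faithful (fp_dual hC) -> faithful (fp_dual hD).
Proof.
move=> faithC M N a b ab.
have : pullback_map F a = pullback_map F b.
  apply: (@faithC (pull M) (pull N)); apply: nattr_ext => A phi.
  exact: (congr1 (fun t : nattr (dual_obj E (sval M)) (dual_obj E (sval N)) =>
    t (F A) phi) ab).
move=> pab; apply: (nattr_ext_quotient qF) => A x.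
exact: (congr1 (fun t : nattr (pullback_obj F (sval N))
  (pullback_obj F (sval M)) => t A x) pab).
Qed.

(** A map between duals over [D] is, after pullback, a map between the duals of
    the pullbacks over [C]. It comes from a map between pullbacks, and this map
    descends to [D]. *)
Lemma dual_full_transfer : full (fp_dual hC) -> full (fp_dual hD).
Proof.
move=> fullC M N h.
pose h' : nattr (dual_obj E (pullback_obj F (sval M)))
                (dual_obj E (pullback_obj F (sval N))) :=
  @NatTr R (op_lcat C) (dual_obj E (pullback_obj F (sval M)))
     (dual_obj E (pullback_obj F (sval N)))
     (fun A => h (F A)) (fun A B f => ntmap_nat h (lfmap F f)).
have [f' f'E] := fullC (pull M) (pull N) h'.
exists (descend_nattr qF f').
apply: (nattr_ext_quotient (op_quotient_functor qF)) => A phi.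
have <- := congr1 (fun t : nattr (dual_obj E (pullback_obj F (sval M)))
                (dual_obj E (pullback_obj F (sval N))) => t A phi) f'E.
by apply: linear_ext => x /=; rewrite -(descend_nattrE qF f').
Qed.

Hypothesis descF : forall M : cmod C,
  (forall A B (f : lhom A B) (x : M A), lfmap F f = 0 -> mmap M f x = 0) ->
  exists M' : cmod D, pullback_obj F M' = M.

(** If the dual of [M] is isomorphic to the pullback of [N], then this dual is
    killed by the morphisms that [F] kills. As linear forms into [E] separate
    the elements of its values, [M] is killed by them too, hence is a pullback
    [M' o F]; the isomorphism then descends as well. *)
Lemma dual_ess_surjective_transfer :
  faithful (fp_dual hC) -> ess_surjective (fp_dual hC) ->
  ess_surjective (fp_dual hD).
Proof.
move=> faithC essC N.
have [[M fpM] [u [v [vu uv]]]] :=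
  essC (exist _ (pullback_obj (op_lfunctor F) (sval N)) (h2 (svalP N))).
rewrite /= in u v vu uv.
have {}vu A phi : v A (u A phi) = phi.
  exact: (congr1 (fun t : nattr (dual_obj E M) (dual_obj E M) => t A phi) vu).
have {}uv A x : u A (v A x) = x.
  exact: (congr1 (fun t : nattr (pullback_obj (op_lfunctor F) (sval N))
    (pullback_obj (op_lfunctor F) (sval N)) => t A x) uv).
have /descF [M' M'E] A B (f : lhom A B) (x : M A) :
    lfmap F f = 0 -> mmap M f x = 0.
  move=> Ff0; apply: (dual_faithful_cogenerates faithC fpM) => phi.
  have zero : mmap (dual_obj E M) f phi = 0.
    by rewrite -[LHS]vu (ntmap_nat u) /= Ff0 mmap0 linear0.
  exact: (congr1 (fun t : {linear M A -> E} => t x) zero).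
subst M.
have fpM' : fin_pres M' by apply: (fin_pres_descends qF).
exists (exist _ M' fpM').
pose DM := pullback_obj (op_lfunctor F) (dual_obj E M').
pose N' := pullback_obj (op_lfunctor F) (sval N).
(* The dual of [M' o F] and the pullback [DM] of the dual of [M'] have the same
   values and the same action by conversion, so [u] and [v] can be retyped. *)
pose u' : nattr DM N' := @NatTr R (op_lcat C) DM N' u (ntmap_nat u).
pose v' : nattr N' DM := @NatTr R (op_lcat C) N' DM v (ntmap_nat v).
pose qop := op_quotient_functor qF.
exists (descend_nattr qop u'), (descend_nattr qop v').
split; apply: (nattr_ext_quotient qop) => A x; rewrite [LHS]/=.
  by rewrite (descend_nattrE qop u') (descend_nattrE qop v'); apply: vu.
by rewrite (descend_nattrE qop v') (descend_nattrE qop u'); apply: uv.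
Qed.

Lemma dual_equivalence_transfer :
  is_equivalence (fp_dual hC) -> is_equivalence (fp_dual hD).
Proof.
move=> eqC; apply: equivalence_of_full_faithful.
- exact/dual_full_transfer/equivalence_full.
- exact/dual_faithful_transfer/equivalence_faithful.
- apply: dual_ess_surjective_transfer.
    exact: equivalence_faithful.
  exact: equivalence_ess_surjective.
Qed.

Lemma dual_pullback_commutes :
  comp_functor (fp_dual hC) (op_functor (fp_pullback h1)) =
  comp_functor (fp_pullback h2) (fp_dual hD).
Proof.
have e M : comp_functor (fp_dual hC) (op_functor (fp_pullback h1)) M =
           comp_functor (fp_pullback h2) (fp_dual hD) M.
  exact/eq_exist/dual_pullback.
apply: (functor_ext (e := e)) => M N a.
exact: fpmod_cast.
Qed.

End Transfer.

(** Pulled back to the opposite of [C], the dual of [M] is the dual of the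
    pullback of [M]. *)
Lemma dual_fp_transfer (E : lmodType R) C D (F : lfunctor C D) :
  quotient_functor F -> pullback_preserves_fp F ->
  dual_preserves_fp E C -> dual_preserves_fp E D.
Proof.
move=> qF h1 hC M fpM; apply: (fin_pres_descends (op_quotient_functor qF)).
by rewrite -dual_pullback; apply: hC; apply: h1.
Qed.

(** * The projection onto the quotient by an ideal *)

Lemma quo_functor_quotient (C : lcat R) (I : ideal C) :
  quotient_functor (quo_functor I).
Proof.
exists (fun P h B => h B) => // A B g.
by have [f ->] := quo_homP g; exists f.
Qed.

Lemma quo_cls0P (C : lcat R) (I : ideal C) (A B : C) (f : lhom A B) :
  quo_cls I f = 0 <-> f \in I A B.
Proof. by rewrite -(linear0 (quo_pi (isub I A B))) quo_clsP subr0. Qed.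

(** The generator [t] is the image of the identity under the epimorphism from a
    representable functor onto [I(X,-)]. *)
Lemma property_A_kernel_generated (C : lcat R) (I : ideal C) :
  property_A I -> kernel_generated (quo_functor I).
Proof.
move=> I_A X; have [[Y [p ep]] _] := I_A X.
exists Y, (val (p Y (lid Y))); split; first exact/quo_cls0P/valP.
move=> A f /quo_cls0P If.
have [g gE] := ep A (exist _ f If : irep I X A).
by exists g; move: gE; rewrite yonedaE => /(congr1 val).
Qed.

Lemma property_A_op_kernel_generated (C : lcat R) (I : ideal C) :
  property_A I -> kernel_generated (op_lfunctor (quo_functor I)).
Proof.
move=> I_A X; have [_ [Y [p ep]]] := I_A X.
exists Y, (val (p Y (lid Y))); split; first exact/(@quo_cls0P C I Y X)/valP.
move=> A f /(@quo_cls0P C I A X) If.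
have [g gE] := ep A (exist _ f If : irep (op_ideal I) (X : op_lcat C) A).
by exists g; move: gE; rewrite yonedaE => /(congr1 val).
Qed.

Lemma cmod_ext (C : lcat R) (U : C -> lmodType R)
    (u v : forall A B : C, lhom A B -> {linear U A -> U B}) lu iu cu lv iv cv :
  (forall A B (f : lhom A B) x, u A B f x = v A B f x) ->
  @CMod R C U u lu iu cu = @CMod R C U v lv iv cv.
Proof.
move=> uv.
have E : u = v.
  do 3![apply: functional_extensionality_dep => ?].
  by apply: linear_ext => x; apply: uv.
by case: v / E lv iv cv {uv} => *; congr CMod; apply: Prop_irrelevance.
Qed.

Section ModDescent.
Variables (C : lcat R) (I : ideal C) (M : cmod C).
Hypothesis MI : forall A B (f : lhom A B) (x : M A),
  f \in I A B -> mmap M f x = 0.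

Definition descend_mmap (A B : C) (f : lhom (A : quo_lcat I) B) :
  {linear M A -> M B} := mmap M (quo_repr f).

Lemma descend_mmap_cls A B (f : lhom A B) x :
  descend_mmap (quo_cls I f) x = mmap M f x.
Proof.
apply/eqP; rewrite -subr_eq0 -mmapB; apply/eqP/MI/quo_clsP.
exact: quo_reprK.
Qed.

Lemma descend_mmap_linear A B (x : M A) :
  linear (fun f : lhom (A : quo_lcat I) B => descend_mmap f x).
Proof.
move=> a f g; have [f0 ->] := quo_homP f; have [g0 ->] := quo_homP g.
by rewrite -quo_cls_linear !descend_mmap_cls (mmap_linear x).
Qed.

Lemma descend_mmap_id A (x : M A) : descend_mmap (lid (A : quo_lcat I)) x = x.
Proof. by rewrite descend_mmap_cls mmap_id. Qed.

Lemma descend_mmap_comp A B X (g : lhom (B : quo_lcat I) X)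
    (f : lhom (A : quo_lcat I) B) (x : M A) :
  descend_mmap (lcomp g f) x = descend_mmap g (descend_mmap f x).
Proof.
have [f0 ->] := quo_homP f; have [g0 ->] := quo_homP g.
by rewrite [lcomp _ _]quo_comp_cls !descend_mmap_cls mmap_comp.
Qed.

Definition descend_mod : cmod (quo_lcat I) :=
  @CMod R (quo_lcat I) M descend_mmap descend_mmap_linear descend_mmap_id
    descend_mmap_comp.

End ModDescent.

(** The morphism that represents a class modulo [I] may differ from [f], but
    both act alike on a functor killed by [I]. *)
Lemma pullback_descend_mod (C : lcat R) (I : ideal C) (M : cmod C)
    (MI : forall A B (f : lhom A B) (x : M A), f \in I A B -> mmap M f x = 0) :
  pullback_obj (quo_functor I) (descend_mod MI) = M.
Proof.
case: M MI => U u lu iu cu MI; apply: cmod_ext => A B f x.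
exact: (descend_mmap_cls MI).
Qed.

End Linear.

Theorem proposition4p6 (R : comPzRingType) (R_artin : artinian R)
    (E : lmodType R) (E_env : is_injective_envelope (quo_rad R) E)
    (C : lcat R) (C_dual : dualizing E C)
    (I : ideal C) (I_A : property_A I) :
  let CI := quo_lcat I in
  let pi1 := quo_functor I in
  let pi2 := op_lfunctor pi1 in
  dualizing E CI /\
  exists (h1 : pullback_preserves_fp pi1) (h2 : pullback_preserves_fp pi2)
         (hC : dual_preserves_fp E C) (hCI : dual_preserves_fp E CI),
    comp_functor (fp_dual hC) (op_functor (fp_pullback h1)) =
    comp_functor (fp_pullback h2) (fp_dual hCI).
Proof.
move=> CI pi1 pi2; have [varC [hC eqC]] := C_dual.
have [addC _ _] := varC.
have q1 := quo_functor_quotient I.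
have h1 : pullback_preserves_fp pi1.
  exact/(pullback_fp q1)/property_A_kernel_generated.
have h2 : pullback_preserves_fp pi2.
  apply: (pullback_fp (op_quotient_functor q1)); first exact: additive_op.
  exact: property_A_op_kernel_generated.
have hCI := dual_fp_transfer q1 h1 hC.
split; last by exists h1, h2, hC, hCI; apply: dual_pullback_commutes.
split; first exact: quotient_variety q1 R_artin varC.
exists hCI; apply: (dual_equivalence_transfer q1 hCI h1 h2 _ eqC) => M MI.
have MI' A B (f : lhom A B) (x : M A) : f \in I A B -> mmap M f x = 0.
  by move=> /quo_cls0P; apply: MI.
by exists (descend_mod MI'); apply: pullback_descend_mod.
Qed.
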